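(* Let $X$ be a smooth projective variety over $\mathbb{C}$ and $X_2$ a primitive double scheme with support $X$ and associated line bundle $L=\mathcal{O}_X$, defined by $\sigma\in H^1(X,T_X)$. Suppose that $\mathcal{I}_{X,X_2}=\mathcal{O}_X$ is extended to a line bundle $\mathbb{L}$ on $X_2$, let $\theta_{\mathbb{L}}\in H^1(X,\mathcal{O}_X)$ be the class associated to $\mathbb{L}$, and let $\eta\in H^1(X,\mathcal{H}_2)$ be the class of the pair $(X_2,\mathbb{L})$. Let $\Delta''_2(\eta)\in H^2(X,T_X)$ be the obstruction to the existence of a primitive multiple scheme $X_3$ of multiplicity $3$ extending $X_2$ with $\mathcal{I}_{X,X_3}=\mathbb{L}$. Then $$\Delta''_2(\eta)=\theta_{\mathbb{L}}\,\sigma+\frac{1}{2}[\sigma,\sigma].$$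
   Context: Primitive multiple schemes. A primitive multiple scheme with support $X$ ($X$ smooth connected of dimension $d$) is a Cohen-Macaulay scheme $Y$ over $\mathbb{C}$ with $Y_{red}=X$ such that every closed point of $X$ has a neighbourhood in $Y$ which is a locally closed subscheme of a smooth variety of dimension $d+1$. Its multiplicity is the smallest $n$ with $\mathcal{I}_X^n=0$, where $\mathcal{I}_X=\mathcal{I}_{X,Y}$ is the ideal sheaf of $X$ in $Y$ (double scheme: $n=2$); its associated line bundle is $L=\mathcal{I}_X/\mathcal{I}_X^2$. $X_3$ extends $X_2$ if the closed subscheme of $X_3$ with ideal $\mathcal{I}_X^2$ is (isomorphic to) $X_2$. Sheaves of groups. For an open $U\subset X$, $\mathcal{G}_n(U)$ is the group of automorphisms of the $\mathbb{C}$-algebra $\mathcal{O}_X(U)[t]/(t^n)$ inducing the identity on its quotient by $(t)$. A primitive multiple scheme of multiplicity $n$ is locally isomorphic to $U\times\mathrm{Spec}(\mathbb{C}[t]/(t^n))$, and with trivializations $\delta_i$ over a cover $(U_i)$ it is described by the cocycle $\delta_{ij}^*=\delta_i^{*-1}\delta_j^*\in\mathcal{G}_n(U_{ij})$. $\mathcal{H}_2(U)$ is the group of pairs $(\phi,u)$ with $\phi\in\mathcal{G}_2(U)$, $u\in\mathcal{O}_X(U)[t]/(t^2)$, $\phi(t)=ut$, with product $(\phi',u')(\phi,u)=(\phi'\phi,u'\phi'(u))$. $H^1(X,\mathcal{H}_2)$ is the set of isomorphism classes of pairs $(X_2,\mathbb{L})$, where $\mathbb{L}$ is a line bundle on $X_2$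 extending $\mathcal{I}_{X,X_2}$: for a cocycle $((\phi_{ij},u_{ij}))$, $(\phi_{ij})$ describes $X_2$ and $(\delta_i^*(u_{ij}))$ is the cocycle of $\mathbb{L}$. The case $L=\mathcal{O}_X$. One can choose the cocycle of $(X_2,\mathbb{L})$ of the form $((\phi_{ij},1+\beta_{ij}t))$ with $\phi_{ij}(f)=f+D_{ij}(f)t$ for $f\in\mathcal{O}_X(U_{ij})$, $\phi_{ij}(t)=t$, $D_{ij}$ a derivation and $\beta_{ij}\in\mathcal{O}_X(U_{ij})$. Then $(D_{ij})$ is a cocycle representing $\sigma\in H^1(X,T_X)$ and $(\beta_{ij})$ is a cocycle representing $\theta_{\mathbb{L}}\in H^1(X,\mathcal{O}_X)$. The product $H^1(X,\mathcal{O}_X)\times H^1(X,T_X)\to H^2(X,T_X)$ is the cup product (represented by $\beta_{ij}D_{jk}$), and $[\,\cdot\,,\cdot\,]:H^1(X,T_X)\times H^1(X,T_X)\to H^2(X,T_X)$ is the bilinear map induced by the bracket of vector fields (represented by $u_{ij}v_{jk}-v_{jk}u_{ij}$). The obstruction. Let $\tau_2:\mathcal{G}_3\to\mathcal{H}_2$ send $\phi$, with $\phi(t)=ut$, to ($\phi$ mod $t^2$, $u$ mod $t^2$). It is surjective with kernel isomorphic to $T_X$ ($D$ corresponds to $f\mapsto f+D(f)t^2$, $t\mapsto t$). For the cocycle $(h_{ij})$ of $\mathcal{H}_2$ representing $\eta$ given by $h_{ij}=(\phi_{ij},1+\beta_{ij}t)$, with $\phi_{ij}(f)=f+D_{ij}(f)t$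 and $\phi_{ij}(t)=t$, choose lifts $g_{ij}\in\mathcal{G}_3(U_{ij})$ with $g_{ji}=g_{ij}^{-1}$; $\Delta''_2(\eta)$ is the class in $H^2(X,T_X)$ of the 2-cocycle $(g_{ij}g_{jk}g_{ki})$. The scheme $X_3$ (with $\mathcal{I}_{X,X_3}=\mathbb{L}$) exists if and only if $\Delta''_2(\eta)=0$. *)

(* Defs.v *)
From HB Require Import structures.
From mathcomp Require Import all_boot all_algebra.
From mathcomp Require Import all_classical reals topology.
From mathcomp Require Import ring.
From mathcomp.real_closed Require Export complex.

Set Implicit Arguments.
Unset Strict Implicit.
Unset Printing Implicit Defensive.

Import GRing.Theory.
Local Open Scope classical_set_scope.
Local Open Scope ring_scope.

Record opens (T : topologicalType) := Opens { oset :> set T; osetP : open oset }.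

Definition omem (T : topologicalType) (U : opens T) : T -> Prop := oset U.
Coercion omem : opens >-> Funclass.

Section Opens.
Variable T : topologicalType.
Implicit Types U V W : opens T.

Definition oI U V : opens T := Opens (openI (osetP U) (osetP V)).
Definition oI3 U V W : opens T := oI (oI U V) W.
Definition oI4 U V W Z : opens T := oI (oI3 U V W) Z.

Lemma orefl U : U `<=` U. Proof. by []. Qed.
Lemma oIl U V : oI U V `<=` U. Proof. by move=> x []. Qed.
Lemma oIr U V : oI U V `<=` V. Proof. by move=> x []. Qed.
Lemma oIC U V : oI U V `<=` oI V U. Proof. by move=> x []. Qed.
Lemma oISS U U' V V' : U `<=` U' -> V `<=` V' -> oI U V `<=` oI U' V'.
Proof. by move=> hU hV x [/hU ? /hV ?]. Qed.
Lemma oI3SS U U' V V' W W' :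
  U `<=` U' -> V `<=` V' -> W `<=` W' -> oI3 U V W `<=` oI3 U' V' W'.
Proof. by move=> hU hV hW; apply: oISS => //; apply: oISS. Qed.

Lemma f12 U V W : oI3 U V W `<=` oI U V. Proof. by move=> x [] []. Qed.
Lemma f23 U V W : oI3 U V W `<=` oI V W. Proof. by move=> x [] []. Qed.
Lemma f13 U V W : oI3 U V W `<=` oI U W. Proof. by move=> x [] []. Qed.
Lemma f31 U V W : oI3 U V W `<=` oI W U. Proof. by move=> x [] []. Qed.

Lemma f123 U V W Z : oI4 U V W Z `<=` oI3 U V W. Proof. by move=> x [] [] []. Qed.
Lemma f124 U V W Z : oI4 U V W Z `<=` oI3 U V Z. Proof. by move=> x [] [] []. Qed.
Lemma f134 U V W Z : oI4 U V W Z `<=` oI3 U W Z. Proof. by move=> x [] [] []. Qed.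
Lemma f234 U V W Z : oI4 U V W Z `<=` oI3 V W Z. Proof. by move=> x [] [] []. Qed.

End Opens.

(* The ring of sections over the empty set is the zero ring, whence
   [comPzRingType]; the K-algebra structure is the ring morphism [cst]. *)
Record algSheaf (K : fieldType) (T : topologicalType) := AlgSheaf {
  asec :> opens T -> comPzRingType;
  ares : forall U V : opens T, V `<=` U -> {rmorphism asec U -> asec V};
  cst : forall U : opens T, {rmorphism K -> asec U};
  ares_id : forall (U : opens T) (h : U `<=` U) s, ares h s = s;
  ares_comp : forall (U V W : opens T) (h : V `<=` U) (h' : W `<=` V)
    (h'' : W `<=` U) s, ares h' (ares h s) = ares h'' s;
  ares_cst : forall (U V : opens T) (h : V `<=` U) c, ares h (cst U c) = cst V c;
  asec_sep : forall (I : Type) (U : opens T) (W : I -> opens T)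
    (h : forall i, W i `<=` U), (forall x, U x -> exists i, W i x) ->
    forall s s' : asec U, (forall i, ares (h i) s = ares (h i) s') -> s = s';
  asec_glue : forall (I : Type) (U : opens T) (W : I -> opens T)
    (h : forall i, W i `<=` U), (forall x, U x -> exists i, W i x) ->
    forall s : forall i, asec (W i),
    (forall i j, ares (@oIl T (W i) (W j)) (s i) = ares (@oIr T (W i) (W j)) (s j)) ->
    exists s0 : asec U, forall i, ares (h i) s0 = s i }.

Arguments ares {K T a U V} h.
Arguments cst {K T} a U.

Section Schemes.
Variables (K : fieldType) (T : topologicalType) (X : algSheaf K T).

Definition unit_at (U : opens T) (s : X U) (x : T) :=
  exists (V : opens T) (h : V `<=` U), V x /\ exists s' : X V, ares h s * s' = 1.

Lemma open_unit_at (U : opens T) (s : X U) : open [set x | unit_at s x].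
Proof.
have -> : [set x | unit_at s x] =
  \bigcup_(V in [set V : opens T | exists h : V `<=` U,
                   exists s' : X V, ares h s * s' = 1]) (V : set T).
  apply/seteqP; split => x.
    by move=> [V [h [Vx ex]]]; exists V => //; exists h.
  by move=> [V [h ex] Vx]; exists V, h.
by apply: bigcup_open => V _; apply: osetP.
Qed.

Definition basic_open (U : opens T) (s : X U) : opens T := Opens (open_unit_at s).

Lemma basic_open_sub (U : opens T) (s : X U) : basic_open s `<=` U.
Proof. by move=> x [V [h [/h]]]. Qed.

Definition prime_ideal (U : opens T) (P : set (X U)) :=
  [/\ P 0, ~ P 1, (forall a b, P a -> P b -> P (a + b)),
      (forall a b, P b -> P (a * b)) & (forall a b, P (a * b) -> P a \/ P b)].

(* The canonical map U -> Spec X(U), x |-> {s | s is not a unit at x}, is a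
   homeomorphism identifying X(D(s)) with the localization X(U)_s. *)
Record affine (U : opens T) : Prop := Affine {
  affine_inj : forall x y, U x -> U y ->
    [set s : X U | ~ unit_at s x] = [set s : X U | ~ unit_at s y] -> x = y;
  affine_prime : forall P : set (X U), prime_ideal P <->
    exists2 x, U x & P = [set s : X U | ~ unit_at s x];
  affine_basis : forall (V : opens T) x, V `<=` U -> V x ->
    exists s : X U, basic_open s x /\ basic_open s `<=` V;
  affine_loc_inj : forall s a : X U, ares (@basic_open_sub U s) a = 0 ->
    exists n, s ^+ n * a = 0;
  affine_loc_surj : forall (s : X U) (b : X (basic_open s)), exists n (a : X U),
    ares (@basic_open_sub U s) a = ares (@basic_open_sub U s) s ^+ n * b }.

Definition is_scheme := forall x, exists2 U : opens T, U x & affine U.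

Definition generates (U : opens T) (S : set (X U)) :=
  forall P : set (X U), S `<=` P -> (forall c, P (cst X U c)) ->
    (forall a b, P a -> P b -> P (a + b)) -> (forall a b, P a -> P b -> P (a * b)) ->
  forall a, P a.

Definition finite_type_alg (U : opens T) :=
  exists n (t : 'I_n -> X U), generates (range t).

Definition formally_smooth_alg (U : opens T) :=
  forall (B B' : comPzRingType) (b : {rmorphism K -> B})
         (p : {rmorphism B -> B'}) (f : {rmorphism X U -> B'}),
    (forall y, exists x, p x = y) -> (forall x y, p x = 0 -> p y = 0 -> x * y = 0) ->
    (forall c, f (cst X U c) = p (b c)) ->
  exists g : {rmorphism X U -> B},
    (forall c, g (cst X U c) = b c) /\ (forall a, p (g a) = f a).

Definition integral := (exists x : T, True) /\
  forall U : opens T, (exists x, U x) ->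
    1 <> 0 :> X U /\ (forall a b : X U, a * b = 0 -> a = 0 \/ b = 0).

(* The diagonal is a closed immersion, tested on products of affine opens. *)
Definition separated := forall U V : opens T, affine U -> affine V ->
  affine (oI U V) /\
  generates (range (@ares _ _ X _ _ (@oIl T U V)) `|` range (@ares _ _ X _ _ (@oIr T U V))).

Definition finite_type := compact [set: T] /\
  forall x, exists U : opens T, [/\ U x, affine U & finite_type_alg U].

Definition variety := [/\ is_scheme, integral, separated & finite_type].

(* Smooth = locally of finite presentation and formally smooth. *)
Definition smooth := forall x, exists U : opens T,
  [/\ U x, affine U, finite_type_alg U & formally_smooth_alg U].

(* A closed immersion into P^N = Proj K[x_0, ..., x_N]: U i is the inverse image
   of the chart x_i <> 0, and t i j is the pullback of x_j / x_i. *)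
Definition projective := exists N (U : 'I_N.+1 -> opens T)
    (t : forall i, 'I_N.+1 -> X (U i)),
  [/\ forall x, exists i, U i x,
      forall i, affine (U i) /\ t i i = 1,
      forall i j, (oI (U i) (U j) : set T) = basic_open (t i j),
      forall i j k, ares (@oIl T (U i) (U j)) (t i k) =
        ares (@oIl T (U i) (U j)) (t i j) * ares (@oIr T (U i) (U j)) (t j k) &
      forall i, generates (range (t i))].

End Schemes.

Section Dimension.
Variable T : topologicalType.

Definition irreducible_closed (F : set T) := [/\ closed F, F !=set0 &
  forall A B, closed A -> closed B -> F `<=` A `|` B -> F `<=` A \/ F `<=` B].

Definition closed_chain (A : set T) (n : nat) (F : nat -> set T) :=
  (forall k, (k <= n)%N -> irreducible_closed (F k) /\ A `<=` F k) /\
  (forall k, (k < n)%N -> F k `<=` F k.+1 /\ F k <> F k.+1).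

(* The dimension of T for A = set0; for A = [set x] in a scheme, the Krull
   dimension of the local ring at x. *)
Definition krull_dim (A : set T) (n : nat) :=
  (exists F, closed_chain A n F) /\ forall m F, closed_chain A m F -> (m <= n)%N.

End Dimension.

Definition smooth_variety (K : fieldType) (T : topologicalType)
    (X : algSheaf K T) (d : nat) :=
  [/\ variety X, smooth X & krull_dim (set0 : set T) d].

Definition smooth_projective_variety (K : fieldType) (T : topologicalType)
    (X : algSheaf K T) (d : nat) := smooth_variety X d /\ projective X.

(* The local ring at x has a regular sequence whose length is its dimension. *)
Definition cohen_macaulay_at (K : fieldType) (T : topologicalType)
    (Y : algSheaf K T) (x : T) :=
  exists r (U : opens T) (f : 'I_r -> Y U),
  [/\ krull_dim [set x] r, U x, forall k, ~ unit_at (f k) x &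
      forall (k : 'I_r) (V : opens T) (h : V `<=` U) (g : Y V), V x ->
        (exists c : 'I_r -> Y V,
           ares h (f k) * g = \sum_(i < r | (i < k)%N) c i * ares h (f i)) ->
        exists (W : opens T) (h' : W `<=` V) (h'' : W `<=` U) (c : 'I_r -> Y W),
          W x /\ ares h' g = \sum_(i < r | (i < k)%N) c i * ares h'' (f i)].

(* A closed immersion of (U, Y|U) into (W, Z|W); [cim_sharp] is the comorphism
   Z(V) -> Y(f^-1 V) followed by the restriction to V'. *)
Record closed_immersion (K : fieldType) (T T' : topologicalType)
    (Y : algSheaf K T) (U : opens T) (Z : algSheaf K T') (W : opens T') := {
  cim : T -> T';
  cim_inj : forall x y, U x -> U y -> cim x = cim y -> x = y;
  cim_open : forall V : set T, V `<=` U -> (open V <->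
    exists2 V' : set T', open V' & V = U `&` cim @^-1` V');
  cim_closed : exists2 C : set T', closed C & cim @` U = W `&` C;
  cim_sharp : forall (V : opens T') (V' : opens T), V `<=` W ->
    V' `<=` U `&` cim @^-1` V -> {rmorphism Z V -> Y V'};
  cim_cst : forall (V : opens T') (V' : opens T) h h' c, @cim_sharp V V' h h' (cst Z V c) = cst Y V' c;
  cim_res : forall (V V1 : opens T') (V' V1' : opens T) h h' h1 h1'
    (k : V1 `<=` V) (k' : V1' `<=` V') (a : Z V),
    @cim_sharp V1 V1' h1 h1' (ares k a) = ares k' (@cim_sharp V V' h h' a);
  cim_surj : forall (V' : opens T) (x : T) (s : Y V'), V' `<=` U -> V' x ->
    exists (V : opens T') (V1 : opens T) (h : V `<=` W)
      (h1 : V1 `<=` U `&` cim @^-1` V) (k : V1 `<=` V') (a : Z V),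
      V1 x /\ @cim_sharp V V1 h h1 a = ares k s }.

Record algSheafMor (K : fieldType) (T : topologicalType) (Y X : algSheaf K T) := {
  amor :> forall U : opens T, {rmorphism Y U -> X U};
  amor_cst : forall U c, amor U (cst Y U c) = cst X U c;
  amor_res : forall (U V : opens T) (h : V `<=` U) s,
    amor V (ares h s) = ares h (amor U s) }.

(* A scheme Y with Y_red = X has the same underlying space as X; the closed
   immersion X -> Y is given by rho : O_Y -> O_X, with ideal sheaf
   I_X = ker rho. *)
Section Primitive.
Variables (K : fieldType) (T : topologicalType) (Y X : algSheaf K T).
Variable rho : algSheafMor Y X.

Definition locally_surjective := forall (U : opens T) (x : T) (f : X U), U x ->
  exists (V : opens T) (h : V `<=` U) (s : Y V), V x /\ rho V s = ares h f.

Definition locally_nilpotent (U : opens T) (s : Y U) := forall x, U x ->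
  exists (V : opens T) (h : V `<=` U) (n : nat), V x /\ ares h s ^+ n = 0.

Definition is_reduction := locally_surjective /\
  forall (U : opens T) (s : Y U), rho U s = 0 <-> locally_nilpotent s.

Definition ideal_pow_zero (n : nat) := forall (U : opens T) (s : 'I_n -> Y U),
  (forall k, rho U (s k) = 0) -> \prod_(k < n) s k = 0.

Definition locally_embeddable (d : nat) := forall x : T, closed [set x] ->
  exists (T' : topologicalType) (Z : algSheaf K T') (U : opens T) (W : opens T'),
    [/\ smooth_variety Z d.+1, U x & inhabited (closed_immersion Y U Z W)].

Record primitive_multiple_scheme (d n : nat) : Prop := {
  pms_scheme : is_scheme Y;
  pms_CM : forall x, cohen_macaulay_at Y x;
  pms_red : is_reduction;
  pms_loc : locally_embeddable d;
  pms_mult : ideal_pow_zero n;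
  pms_min : forall m, (m < n)%N -> ~ ideal_pow_zero m }.

(* For n = 2, I_X^2 = 0 and the associated line bundle I_X/I_X^2 is I_X; its
   O_X-module structure is induced by the multiplication of O_Y. *)
Definition associated_bundle_trivial :=
  exists lam : forall U : opens T, X U -> Y U,
  [/\ forall U f f', lam U (f + f') = lam U f + lam U f',
      forall U s f, lam U (rho U s * f) = s * lam U f,
      forall (U V : opens T) (h : V `<=` U) f, lam V (ares h f) = ares h (lam U f),
      forall U, injective (lam U) &
      forall U s, rho U s = 0 <-> exists f, s = lam U f].

End Primitive.

Record modPresheaf (K : fieldType) (T : topologicalType) (O : algSheaf K T) := {
  msec :> forall U : opens T, lmodType (O U);
  mres : forall U V : opens T, V `<=` U -> {additive msec U -> msec V};
  mresZ : forall (U V : opens T) (h : V `<=` U) (a : O U) (s : msec U),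
    mres h (a *: s) = ares h a *: mres h s;
  mres_id : forall (U : opens T) (h : U `<=` U) s, mres h s = s;
  mres_comp : forall (U V W : opens T) (h : V `<=` U) (h' : W `<=` V)
    (h'' : W `<=` U) s, mres h' (mres h s) = mres h'' s }.

Arguments mres {K T O m U V} h.

Section Modules.
Variables (K : fieldType) (T : topologicalType) (O : algSheaf K T).

Definition is_sheaf (F : modPresheaf O) :=
  forall (I : Type) (U : opens T) (W : I -> opens T)
    (h : forall i, W i `<=` U), (forall x, U x -> exists i, W i x) ->
  (forall s s' : F U, (forall i, mres (h i) s = mres (h i) s') -> s = s') /\
  (forall s : forall i, F (W i),
    (forall i j, mres (@oIl T (W i) (W j)) (s i) = mres (@oIr T (W i) (W j)) (s j)) ->
    exists s0 : F U, forall i, mres (h i) s0 = s i).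

Definition generator (F : modPresheaf O) (U : opens T) (s : F U) :=
  forall (V : opens T) (h : V `<=` U), bijective (fun a : O V => a *: mres h s).

Definition line_bundle (F : modPresheaf O) := is_sheaf F /\
  forall x, exists (U : opens T) (s : F U), U x /\ generator s.

Definition structure_module : modPresheaf O.
Proof.
refine (@Build_modPresheaf K T O (fun U => (O U)^o) (fun U V h => ares h) _ _ _).
- by move=> U V h a s; rewrite /= [LHS]rmorphM.
- exact: ares_id.
- exact: ares_comp.
Defined.

End Modules.

(* The restriction L|_X = L / I_X L of a line bundle L on Y is isomorphic to
   I_X: kap induces the isomorphism. *)
Definition extends_ideal (K : fieldType) (T : topologicalType) (Y X : algSheaf K T)
    (rho : algSheafMor Y X) (L : modPresheaf Y) :=
  exists kap : forall U : opens T, L U -> Y U,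
  [/\ (forall U m m', kap U (m + m') = kap U m + kap U m') /\
        (forall U a m, kap U (a *: m) = a * kap U m),
      forall (U V : opens T) (h : V `<=` U) m, kap V (mres h m) = ares h (kap U m),
      forall U m, rho U (kap U m) = 0,
      forall (U : opens T) (x : T) (s : Y U), U x -> rho U s = 0 ->
        exists (V : opens T) (h : V `<=` U) (m : L V), V x /\ kap V m = ares h s &
      forall (U : opens T) (m : L U), kap U m = 0 <-> forall x, U x ->
        exists (V : opens T) (h : V `<=` U) (r : nat) (a : 'I_r -> Y V) (l : 'I_r -> L V),
          [/\ V x, forall i, rho V (a i) = 0 & mres h m = \sum_(i < r) a i *: l i]].

Record der (K : fieldType) (T : topologicalType) (X : algSheaf K T) (U : opens T) := Der {
  dfun : forall V : opens T, V `<=` U -> X V -> X V;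
  der_add : forall (V : opens T) (h : V `<=` U) a b, dfun h (a + b) = dfun h a + dfun h b;
  der_mul : forall (V : opens T) (h : V `<=` U) a b, dfun h (a * b) = dfun h a * b + a * dfun h b;
  der_cst : forall (V : opens T) (h : V `<=` U) c, dfun h (cst X V c) = 0;
  der_res : forall (V W : opens T) (h : V `<=` U) (h' : W `<=` V) (h'' : W `<=` U) a,
    dfun h'' (ares h' a) = ares h' (dfun h a) }.

Section Tangent.
Variables (K : fieldType) (T : topologicalType) (X : algSheaf K T).

Section Ops.
Variable U : opens T.
Implicit Types D E : der X U.

HB.instance Definition _ := gen_eqMixin (der X U).
HB.instance Definition _ := gen_choiceMixin (der X U).

Lemma der_ext D E :
  (forall (V : opens T) (h : V `<=` U) a, dfun D h a = dfun E h a) -> D = E.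
Proof.
case: D E => [d d1 d2 d3 d4] [e e1 e2 e3 e4] /= hde.
have ede : d = e.
  apply: functional_extensionality_dep => V.
  by apply: functional_extensionality_dep => h; apply/funext => a.
subst e; congr Der; exact: Prop_irrelevance.
Qed.

Definition der_zero : der X U.
Proof.
exists (fun V _ _ => 0) => *; rewrite ?addr0 ?mul0r ?mulr0 ?addr0 //.
by rewrite raddf0.
Defined.

Definition der_opp D : der X U.
Proof.
exists (fun V h a => - dfun D h a).
- by move=> V h a b; rewrite der_add opprD.
- by move=> V h a b; rewrite der_mul opprD mulNr mulrN.
- by move=> V h c; rewrite der_cst oppr0.
- by move=> V W h h' h'' a; rewrite (der_res D h) raddfN.
Defined.

Definition der_plus D E : der X U.
Proof.
exists (fun V h a => dfun D h a + dfun E h a).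
- by move=> V h a b; rewrite !der_add addrACA.
- by move=> V h a b; rewrite !der_mul mulrDl mulrDr addrACA.
- by move=> V h c; rewrite !der_cst addr0.
- by move=> V W h h' h'' a; rewrite (der_res D h) (der_res E h) raddfD.
Defined.

Definition der_scale (f : X U) D : der X U.
Proof.
exists (fun V h a => ares h f * dfun D h a).
- by move=> V h a b; rewrite der_add mulrDr.
- by move=> V h a b; rewrite der_mul mulrDr mulrA [a * (_ * _)]mulrCA.
- by move=> V h c; rewrite der_cst mulr0.
- by move=> V W h h' h'' a; rewrite (der_res D h) rmorphM ares_comp.
Defined.

Definition der_bracket D E : der X U.
Proof.
exists (fun V h a => dfun D h (dfun E h a) - dfun E h (dfun D h a)).
- by move=> V h a b; rewrite !der_add opprD addrACA.
- move=> V h a b; rewrite !der_mul !der_add !der_mul mulrBl mulrBr.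
  ring.
- by move=> V h c; rewrite !der_cst -{1}[0](rmorph0 (cst X V))
    -[X in _ - dfun _ _ X](rmorph0 (cst X V)) !der_cst subr0.
- by move=> V W h h' h'' a; rewrite !(der_res D h, der_res E h) raddfB.
Defined.

Lemma der_addA : associative der_plus.
Proof. by move=> D E F; apply: der_ext => V h a /=; rewrite addrA. Qed.
Lemma der_addC : commutative der_plus.
Proof. by move=> D E; apply: der_ext => V h a /=; rewrite addrC. Qed.
Lemma der_add0 : left_id der_zero der_plus.
Proof. by move=> D; apply: der_ext => V h a /=; rewrite add0r. Qed.
Lemma der_addN : left_inverse der_zero der_opp der_plus.
Proof. by move=> D; apply: der_ext => V h a /=; rewrite addNr. Qed.
HB.instance Definition _ :=
  GRing.isZmodule.Build (der X U) der_addA der_addC der_add0 der_addN.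

Lemma der_scaleA f g D : der_scale f (der_scale g D) = der_scale (f * g) D.
Proof. by apply: der_ext => V h a /=; rewrite rmorphM mulrA. Qed.
Lemma der_scale1 : left_id 1 der_scale.
Proof. by move=> D; apply: der_ext => V h a /=; rewrite rmorph1 mul1r. Qed.
Lemma der_scaleDr : right_distributive der_scale +%R.
Proof. by move=> f D E; apply: der_ext => V h a /=; rewrite mulrDr. Qed.
Lemma der_scaleDl D : {morph der_scale^~ D : f g / f + g}.
Proof. by move=> f g; apply: der_ext => V h a /=; rewrite rmorphD mulrDl. Qed.
HB.instance Definition _ := GRing.Zmodule_isLmodule.Build (X U) (der X U)
  der_scaleA der_scale1 der_scaleDr der_scaleDl.

End Ops.

Definition der_restr (U V : opens T) (h : V `<=` U) (D : der X U) : der X V.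
Proof.
exists (fun W k => dfun D (subset_trans k h)).
- by move=> W k a b; rewrite der_add.
- by move=> W k a b; rewrite der_mul.
- by move=> W k c; rewrite der_cst.
- by move=> W W' k k' k'' a; rewrite (der_res D (subset_trans k h)).
Defined.

Lemma der_restr_zmod (U V : opens T) (h : V `<=` U) : zmod_morphism (der_restr h).
Proof. by move=> D E; apply: der_ext. Qed.
HB.instance Definition _ (U V : opens T) (h : V `<=` U) :=
  GRing.isZmodMorphism.Build (der X U) (der X V) (der_restr h) (der_restr_zmod h).

Definition tangent : modPresheaf X.
Proof.
refine (@Build_modPresheaf K T X (fun U => der X U) (fun U V h => der_restr h) _ _ _).
- by move=> U V h f D; apply: der_ext => W k a; rewrite /= (ares_comp h k (subset_trans k h)).
- by move=> U h D; apply: der_ext => V k a; congr (dfun D _ a).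
- by move=> U V W h h' h'' D; apply: der_ext => Z k a; congr (dfun D _ a).
Defined.

End Tangent.

Record cover (T : topologicalType) := Cover {
  cidx : Type;
  copen :> cidx -> opens T;
  coverP : forall x, exists i, copen i x }.

Section Cech.
Variables (K : fieldType) (T : topologicalType) (O : algSheaf K T).

Record cech1 (F : modPresheaf O) (U : cover T) := Cech1 {
  c1 :> forall i j : cidx U, F (oI (U i) (U j));
  c1P : forall i j k, mres (@f23 T (U i) (U j) (U k)) (c1 j k)
    - mres (@f13 T (U i) (U j) (U k)) (c1 i k)
    + mres (@f12 T (U i) (U j) (U k)) (c1 i j) = 0 }.

Record cech2 (F : modPresheaf O) (U : cover T) := Cech2 {
  c2 :> forall i j k : cidx U, F (oI3 (U i) (U j) (U k));
  c2P : forall i j k l, mres (@f234 T (U i) (U j) (U k) (U l)) (c2 j k l)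
    - mres (@f134 T (U i) (U j) (U k) (U l)) (c2 i k l)
    + mres (@f124 T (U i) (U j) (U k) (U l)) (c2 i j l)
    - mres (@f123 T (U i) (U j) (U k) (U l)) (c2 i j k) = 0 }.

Lemma cech1_rel (F : modPresheaf O) (U : cover T) (a : cech1 F U) i j k
    (V : opens T) (hij : V `<=` oI (U i) (U j)) (hjk : V `<=` oI (U j) (U k))
    (hik : V `<=` oI (U i) (U k)) :
  mres hik (a i k) = mres hij (a i j) + mres hjk (a j k).
Proof.
have hV : V `<=` oI3 (U i) (U j) (U k).
  by move=> x Vx; have [? ?] := hij x Vx; have [? ?] := hik x Vx.
have := congr1 (mres hV) (c1P a i j k).
rewrite raddf0 raddfD raddfB /= !(mres_comp _ _ hij, mres_comp _ _ hjk, mres_comp _ _ hik).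
by move/eqP; rewrite addrAC subr_eq0 addrC => /eqP.
Qed.

Definition refines (W U : cover T) (r : cidx W -> cidx U) :=
  forall k, W k `<=` U (r k).

(* Two cocycles, possibly on different covers, have the same class when they
   differ by a coboundary on a common refinement. *)
Definition cech1_eq (F : modPresheaf O) (a b : {U : cover T & cech1 F U}) :=
  exists (W : cover T) (r : cidx W -> cidx (tag a)) (s : cidx W -> cidx (tag b))
         (hr : refines r) (hs : refines s) (c : forall k, F (W k)),
  forall k l, mres (oISS (hs k) (hs l)) (tagged b (s k) (s l))
    - mres (oISS (hr k) (hr l)) (tagged a (r k) (r l))
    = mres (@oIr T (W k) (W l)) (c l) - mres (@oIl T (W k) (W l)) (c k).

Definition cech2_eq (F : modPresheaf O) (a b : {U : cover T & cech2 F U}) :=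
  exists (W : cover T) (r : cidx W -> cidx (tag a)) (s : cidx W -> cidx (tag b))
         (hr : refines r) (hs : refines s) (c : forall k l, F (oI (W k) (W l))),
  forall k l m,
    mres (oI3SS (hs k) (hs l) (hs m)) (tagged b (s k) (s l) (s m))
    - mres (oI3SS (hr k) (hr l) (hr m)) (tagged a (r k) (r l) (r m))
    = mres (@f23 T (W k) (W l) (W m)) (c l m)
      - mres (@f13 T (W k) (W l) (W m)) (c k m)
      + mres (@f12 T (W k) (W l) (W m)) (c k l).

(* H^p(X, F) is the direct limit of the H^p(U, F) over the open covers U; a
   class is the set of the cocycles, on all covers, that represent it. *)
Definition H1 (F : modPresheaf O) := set {U : cover T & cech1 F U}.
Definition H2 (F : modPresheaf O) := set {U : cover T & cech2 F U}.

Definition class1 (F : modPresheaf O) (U : cover T) (a : cech1 F U) : H1 F :=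
  [set b | cech1_eq (existT _ U a) b].
Definition class2 (F : modPresheaf O) (U : cover T) (a : cech2 F U) : H2 F :=
  [set b | cech2_eq (existT _ U a) b].

Definition cech2_add (F : modPresheaf O) (U : cover T) (a b : cech2 F U) : cech2 F U.
Proof.
exists (fun i j k => a i j k + b i j k) => i j k l.
rewrite !raddfD /=.
have -> (V : zmodType) (a1 a2 a3 a4 b1 b2 b3 b4 : V) :
    (a1 + b1) + (a2 + b2) + (a3 + b3) + (a4 + b4) =
    (a1 + a2 + a3 + a4) + (b1 + b2 + b3 + b4).
  by rewrite (addrACA a1) (addrACA (a1 + a2)) (addrACA (a1 + a2 + a3)).
by rewrite !c2P addr0.
Defined.

Definition cech2_scale (F : modPresheaf O) (U : cover T) (z : K) (a : cech2 F U) :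
  cech2 F U.
Proof.
exists (fun i j k => cst O _ z *: a i j k) => i j k l.
by rewrite !mresZ !ares_cst -!scalerN -!scalerDr c2P scaler0.
Defined.

Definition H2_add (F : modPresheaf O) (A B : H2 F) : H2 F :=
  [set w | exists (U : cover T) (a b : cech2 F U),
    [/\ A (existT _ U a), B (existT _ U b) & class2 (cech2_add a b) w]].

Definition H2_scale (F : modPresheaf O) (z : K) (A : H2 F) : H2 F :=
  [set w | exists (U : cover T) (a : cech2 F U),
    A (existT _ U a) /\ class2 (cech2_scale z a) w].

End Cech.

Section Products.
Variables (K : fieldType) (T : topologicalType) (X : algSheaf K T).
Local Notation OX := (structure_module X).
Local Notation TX := (tangent X).

Definition cech_cup (U : cover T) (b : cech1 OX U) (D : cech1 TX U) : cech2 TX U.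
Proof.
exists (fun i j k => ares (@f12 T (U i) (U j) (U k)) (b i j) *:
                     mres (@f23 T (U i) (U j) (U k)) (D j k)) => i j k l.
rewrite !mresZ.
have h12 := subset_trans (@f123 T (U i) (U j) (U k) (U l)) (@f12 _ _ _ _).
have h23 := subset_trans (@f123 T (U i) (U j) (U k) (U l)) (@f23 _ _ _ _).
have h13 := subset_trans (@f123 T (U i) (U j) (U k) (U l)) (@f13 _ _ _ _).
have h34 := subset_trans (@f234 T (U i) (U j) (U k) (U l)) (@f23 _ _ _ _).
have h24 := subset_trans (@f234 T (U i) (U j) (U k) (U l)) (@f13 _ _ _ _).
rewrite !(ares_comp _ _ h12) !(ares_comp _ _ h23) !(ares_comp _ _ h13).
rewrite !(mres_comp _ _ h23) !(mres_comp _ _ h34) !(mres_comp _ _ h24).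
have -> : ares h13 (b i k) = ares h12 (b i j) + ares h23 (b j k) :=
  cech1_rel b h12 h23 h13.
rewrite (cech1_rel D h23 h34 h24) scalerDl scalerDr.
have -> (V : zmodType) (x y z : V) : y - (x + y) + (z + x) - z = 0.
  have -> : y - (x + y) = - x by rewrite opprD addrCA subrr addr0.
  by rewrite (addrC z x) addKr subrr.
by [].
Defined.

Definition cech_bracket (U : cover T) (D E : cech1 TX U) : cech2 TX U.
Proof.
exists (fun i j k => der_bracket (mres (@f12 T (U i) (U j) (U k)) (D i j))
                                 (mres (@f23 T (U i) (U j) (U k)) (E j k)))
  => i j k l.
have h12 := subset_trans (@f123 T (U i) (U j) (U k) (U l)) (@f12 _ _ _ _).
have h23 := subset_trans (@f123 T (U i) (U j) (U k) (U l)) (@f23 _ _ _ _).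
have h13 := subset_trans (@f123 T (U i) (U j) (U k) (U l)) (@f13 _ _ _ _).
have h34 := subset_trans (@f234 T (U i) (U j) (U k) (U l)) (@f23 _ _ _ _).
have h24 := subset_trans (@f234 T (U i) (U j) (U k) (U l)) (@f13 _ _ _ _).
have resB (V W : opens T) (h : V `<=` W) (D' E' : der X W) :
  mres (m := TX) h (der_bracket D' E') =
  der_bracket (mres (m := TX) h D') (mres (m := TX) h E') by apply: der_ext.
rewrite !resB.
rewrite !(mres_comp _ _ h12) !(mres_comp _ _ h23) !(mres_comp _ _ h13).
rewrite !(mres_comp _ _ h34) !(mres_comp _ _ h24).
rewrite (cech1_rel D h12 h23 h13) (cech1_rel E h23 h34 h24).
apply: der_ext => V h a /=; rewrite !der_add.
ring.
Defined.

Definition cup (A : H1 OX) (B : H1 TX) : H2 TX :=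
  [set w | exists (U : cover T) (b : cech1 OX U) (D : cech1 TX U),
    [/\ A (existT _ U b), B (existT _ U D) & class2 (cech_cup b D) w]].

Definition bracket (A B : H1 TX) : H2 TX :=
  [set w | exists (U : cover T) (D E : cech1 TX U),
    [/\ A (existT _ U D), B (existT _ U E) & class2 (cech_bracket D E) w]].

End Products.

(* A[t]/(t^n), the index i : 'I_n giving the coefficient of t^i *)
Definition tpoly (n : nat) (A : comPzRingType) : Type := {ffun 'I_n -> A}.

Section TruncatedPoly.
Variable n : nat.

Section Ring.
Variable A : comPzRingType.
Implicit Types (a b : tpoly n A) (c : A).

HB.instance Definition _ := GRing.Zmodule.on (tpoly n A).

Definition tcoef a (k : nat) : A := if insub k is Some i then a i else 0.

Definition tmon (c : A) (m : nat) : tpoly n A :=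
  [ffun k : 'I_n => if k == m :> nat then c else 0].

Definition tmul a b : tpoly n A :=
  [ffun k : 'I_n => \sum_(i < k.+1) tcoef a i * tcoef b (k - i)].

Lemma tcoefE a (k : 'I_n) : tcoef a k = a k.
Proof. by rewrite /tcoef valK. Qed.

Lemma tcoef_mul a b k : (k < n)%N ->
  tcoef (tmul a b) k = \sum_(i < k.+1) tcoef a i * tcoef b (k - i).
Proof. by move=> lt_k_n; rewrite -[k]/(nat_of_ord (Ordinal lt_k_n)) tcoefE ffunE. Qed.

Lemma tcoefD a b k : tcoef (a + b) k = tcoef a k + tcoef b k.
Proof. by rewrite /tcoef; case: insubP => [i _ _|_]; rewrite ?ffunE ?addr0. Qed.

Lemma tmulC : commutative tmul.
Proof.
move=> a b; apply/ffunP => k; rewrite !ffunE (reindex_inj rev_ord_inj) /=.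
by apply: eq_bigr => i _; rewrite mulrC subSS subKn // -ltnS.
Qed.

Lemma tmulA : associative tmul.
Proof.
move=> p q r; apply/ffunP => k; rewrite !ffunE.
pose coef3 j l := tcoef p j * (tcoef q (k - j - l)%N * tcoef r l).
transitivity (\sum_(j < k.+1) \sum_(l < k.+1 | (l <= k - j)%N) coef3 j l).
  apply: eq_bigr => /= j _.
  rewrite tmulC tcoef_mul ?(leq_ltn_trans (leq_subr _ _)) // big_distrr /=.
  rewrite (big_ord_narrow_leq (leq_subr _ _)) /=.
  by apply: eq_bigr => l _; rewrite /coef3 [tcoef r _ * _]mulrC.
rewrite (exchange_big_dep predT) //= (reindex_inj rev_ord_inj) /=.
apply: eq_bigr => l _; rewrite subSS.
have lk : (l <= k)%N by rewrite -ltnS.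
transitivity (\sum_(j < k.+1 | (j <= l)%N) coef3 j (k - l)%N).
  apply: eq_bigl => j; have jk : (j <= k)%N by rewrite -ltnS.
  by rewrite leq_sub2lE.
rewrite (big_ord_narrow_leq lk) tcoef_mul ?(leq_ltn_trans lk) // big_distrl /=.
apply: eq_bigr => j _; rewrite /coef3 mulrA; congr (_ * tcoef q _ * _).
by rewrite subnAC subKn.
Qed.

Lemma tcoef_mon c m k : (k < n)%N -> tcoef (tmon c m) k = if k == m then c else 0.
Proof. by move=> lt_k_n; rewrite -[k in LHS]/(nat_of_ord (Ordinal lt_k_n)) tcoefE ffunE. Qed.

Lemma tmul1 : left_id (tmon 1 0) tmul.
Proof.
move=> a; apply/ffunP => k; rewrite ffunE big_ord_recl big1 => [|i _].
  by rewrite tcoef_mon ?(leq_ltn_trans _ (ltn_ord k)) //= subn0 mul1r addr0 tcoefE.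
by rewrite tcoef_mon ?mul0r // (leq_ltn_trans _ (ltn_ord k)) // ltn_ord.
Qed.

Lemma tmulDl : left_distributive tmul +%R.
Proof.
move=> a b d; apply/ffunP => k; rewrite !ffunE -big_split /=.
by apply: eq_bigr => i _; rewrite tcoefD mulrDl.
Qed.

HB.instance Definition _ := GRing.Zmodule_isComPzRing.Build (tpoly n A)
  tmulA tmulC tmul1 tmulDl.

End Ring.

Definition tmap (A B : comPzRingType) (f : A -> B) (a : tpoly n A) : tpoly n B :=
  [ffun k => f (a k)].

Lemma tcoef_map (A B : comPzRingType) (f : {rmorphism A -> B}) (a : tpoly n A) k :
  tcoef (tmap f a) k = f (tcoef a k).
Proof. by rewrite /tcoef; case: insubP => [i _ _|_]; rewrite ?ffunE ?rmorph0. Qed.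

Lemma tmapM (A B : comPzRingType) (f : {rmorphism A -> B}) (a b : tpoly n A) :
  tmap f (a * b) = tmap f a * tmap f b.
Proof.
apply/ffunP => k; rewrite !ffunE rmorph_sum; apply: eq_bigr => i _.
by rewrite rmorphM !tcoef_map.
Qed.

End TruncatedPoly.

Arguments tmon {n A} c m.

Definition ttrunc (n m : nat) (A : comPzRingType) (a : tpoly n A) : tpoly m A :=
  [ffun k : 'I_m => tcoef a k].

Section Groups.
Variables (K : fieldType) (T : topologicalType) (X : algSheaf K T).

(* The group G_n(U). On an affine U, an automorphism of the sheaf of K-algebras
   O_X[t]/(t^n) is the same as an automorphism of O_X(U)[t]/(t^n); on a general U
   only the former restricts to smaller opens. Likewise for [der] above. *)
Record gaut (n : nat) (U : opens T) := Gaut {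
  gfun : forall V : opens T, V `<=` U -> {rmorphism tpoly n (X V) -> tpoly n (X V)};
  gfun_bij : forall (V : opens T) (h : V `<=` U), bijective (gfun h);
  gfun_cst : forall (V : opens T) (h : V `<=` U) c,
    gfun h (tmon (cst X V c) 0) = tmon (cst X V c) 0;
  gfun_mod : forall (V : opens T) (h : V `<=` U) a, tcoef (gfun h a) 0 = tcoef a 0;
  gfun_res : forall (V W : opens T) (h : V `<=` U) (k : W `<=` V) (h' : W `<=` U) a,
    gfun h' (tmap (ares k) a) = tmap (ares k) (gfun h a) }.

Definition gid (n : nat) (U : opens T) : gaut n U.
Proof.
by exists (fun V h => idfun : {rmorphism tpoly n (X V) -> tpoly n (X V)}) => // V h;
  exists id.
Defined.

Definition gcomp (n : nat) (U : opens T) (g g' : gaut n U) : gaut n U.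
Proof.
exists (fun V h => gfun g h \o gfun g' h : {rmorphism tpoly n (X V) -> tpoly n (X V)}).
- by move=> V h; apply: bij_comp; apply: gfun_bij.
- by move=> V h c /=; rewrite !gfun_cst.
- by move=> V h a /=; rewrite !gfun_mod.
- by move=> V W h k h' a /=; rewrite (gfun_res g' h) (gfun_res g h).
Defined.

Definition grestr (n : nat) (U V : opens T) (h : V `<=` U) (g : gaut n U) : gaut n V.
Proof.
exists (fun W k => gfun g (subset_trans k h)).
- by move=> W k; apply: gfun_bij.
- by move=> W k c; apply: gfun_cst.
- by move=> W k a; apply: gfun_mod.
- by move=> W W' k k' k'' a; apply: gfun_res.
Defined.

(* The group H_2(U), with product (phi', u')(phi, u) = (phi' phi, u' phi'(u)). *)
Record h2grp (U : opens T) := H2grp {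
  h2phi : gaut 2 U;
  h2u : tpoly 2 (X U);
  h2phi_t : forall (V : opens T) (h : V `<=` U),
    gfun h2phi h (tmon 1 1) = tmap (ares h) h2u * tmon 1 1 }.

Definition h2mul (U : opens T) (h h' : h2grp U) : h2grp U.
Proof.
exists (gcomp (h2phi h) (h2phi h')) (h2u h * gfun (h2phi h) (@orefl T U) (h2u h')).
move=> V k /=; rewrite h2phi_t rmorphM h2phi_t (gfun_res (h2phi h) (@orefl T U) k k).
by rewrite tmapM mulrA; congr (_ * _); rewrite mulrC.
Defined.

Definition h2restr (U V : opens T) (k : V `<=` U) (h : h2grp U) : h2grp V.
Proof.
exists (grestr k (h2phi h)) (tmap (ares k) (h2u h)).
move=> W l /=; rewrite h2phi_t; congr (_ * _); apply/ffunP => i.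
by rewrite !ffunE (ares_comp k l (subset_trans l k)).
Defined.

Record h2cocycle := H2cocycle {
  hcov : cover T;
  hcoc :> forall i j : cidx hcov, h2grp (oI (hcov i) (hcov j));
  hcocP : forall i j k,
    h2mul (h2restr (@f12 T (hcov i) (hcov j) (hcov k)) (hcoc i j))
          (h2restr (@f23 T (hcov i) (hcov j) (hcov k)) (hcoc j k)) =
    h2restr (@f13 T (hcov i) (hcov j) (hcov k)) (hcoc i k) }.

(* phi_ij(f) = f + D_ij(f) t, phi_ij(t) = t and u_ij = 1 + b_ij t *)
Definition normal_form (h : h2cocycle) (D : cech1 (tangent X) (hcov h))
    (b : cech1 (structure_module X) (hcov h)) :=
  forall i j, h2u (h i j) = tmon 1 0 + tmon (b i j) 1 /\
  forall (V : opens T) (k : V `<=` oI (hcov h i) (hcov h j)),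
    gfun (h2phi (h i j)) k (tmon 1 1) = tmon 1 1 /\
    forall f, gfun (h2phi (h i j)) k (tmon f 0) =
              tmon f 0 + tmon (dfun (D i j) k f) 1.

Definition tau2_lift (U : opens T) (g : gaut 3 U) (h : h2grp U) :=
  (forall (V : opens T) (k : V `<=` U) a,
     ttrunc 2 (gfun g k a) = gfun (h2phi h) k (ttrunc 2 a)) /\
  exists u : tpoly 3 (X U), gfun g (@orefl T U) (tmon 1 1) = u * tmon 1 1 /\
    ttrunc 2 u = h2u h.

(* The kernel of tau_2 is T_X: D corresponds to f |-> f + D(f) t^2, t |-> t. *)
Definition is_ker_tau2 (U : opens T) (g : gaut 3 U) (D : der X U) :=
  forall (V : opens T) (k : V `<=` U), gfun g k (tmon 1 1) = tmon 1 1 /\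
    forall f, gfun g k (tmon f 0) = tmon f 0 + tmon (dfun D k f) 2.

(* w is the value of Delta''_2 on h, computed from some choice of lifts. *)
Definition is_Delta2 (h : h2cocycle) (w : H2 (tangent X)) :=
  exists (g : forall i j, gaut 3 (oI (hcov h i) (hcov h j)))
         (c : cech2 (tangent X) (hcov h)),
  [/\ forall i j, tau2_lift (g i j) (h i j),
      forall i j, gcomp (g i j) (grestr (@oIC T _ _) (g j i)) = gid _ _,
      forall i j k, is_ker_tau2
        (gcomp (gcomp (grestr (@f12 T _ _ _) (g i j)) (grestr (@f23 T _ _ _) (g j k)))
               (grestr (@f31 T _ _ _) (g k i))) (c i j k) &
      w = class2 c].

End Groups.

Section Pairs.
Variables (K : fieldType) (T : topologicalType) (Y X : algSheaf K T).
Variables (rho : algSheafMor Y X) (L : modPresheaf Y).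

(* delta^* : O_X[t]/(t^2) -> O_Y over U, inducing the identity of O_X *)
Record trivialization (U : opens T) := {
  triv :> forall V : opens T, V `<=` U -> {rmorphism tpoly 2 (X V) -> Y V};
  triv_bij : forall (V : opens T) (h : V `<=` U), bijective (triv h);
  triv_cst : forall (V : opens T) (h : V `<=` U) c,
    triv h (tmon (cst X V c) 0) = cst Y V c;
  triv_rho : forall (V : opens T) (h : V `<=` U) a, rho V (triv h a) = tcoef a 0;
  triv_res : forall (V W : opens T) (h : V `<=` U) (k : W `<=` V) (h' : W `<=` U) a,
    triv h' (tmap (ares k) a) = ares k (triv h a) }.

(* The class of (Y, L) in H^1(X, H_2), as the set of the cocycles describing it:
   phi_ij = delta_i^*-1 delta_j^*, and local generators e_i of L satisfy
   e_j = delta_i^*(u_ij) e_i, as t does when L is the ideal sheaf of a triple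
   scheme, where delta_j^*(t) = delta_i^*(u_ij t). *)
Definition pair_class : set (h2cocycle X) :=
  [set h | exists (delta : forall i, trivialization (hcov h i))
                  (e : forall i, L (hcov h i)),
    [/\ forall i, generator (e i),
        forall i j (V : opens T) (k : V `<=` oI (hcov h i) (hcov h j)) a,
          triv (delta i) (subset_trans k (@oIl T _ _)) (gfun (h2phi (h i j)) k a) =
          triv (delta j) (subset_trans k (@oIr T _ _)) a &
        forall i j, mres (@oIr T (hcov h i) (hcov h j)) (e j) =
          triv (delta i) (@oIl T _ _) (h2u (h i j)) *:
            mres (@oIl T (hcov h i) (hcov h j)) (e i)]].

End Pairs.

(* Main.v *)
(* A lift of (phi_ij, 1 + b_ij t) to G_3 has the form f |-> f + D_ij(f) t +
   E_ij(f) t^2, t |-> t + b_ij t^2. Multiplicativity says that E_ij has the same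
   Leibniz defect as D_ij^2 / 2, so F_ij := E_ij - D_ij^2 / 2 is a derivation.
   Comparing the coefficients of t^2 in g_ij g_jk = (1 + c_ijk t^2) g_ik gives
   c_ijk = E_ij + E_jk - E_ik + D_ij D_jk + b_ij D_jk, and since
   D_ik = D_ij + D_jk this is b_ij D_jk + [D_ij, D_jk] / 2 plus the coboundary
   of F. *)
Require Import Defs.
From HB Require Import structures.
From mathcomp Require Import all_boot all_algebra.
From mathcomp Require Import all_classical reals topology.
From mathcomp Require Import ring.
From mathcomp.real_closed Require Import complex.

Import GRing.Theory.
Local Open Scope classical_set_scope.
Local Open Scope ring_scope.

Section CechObstruction.

Local Notation cover := Defs.cover.

Set Implicit Arguments.
Unset Strict Implicit.
Unset Printing Implicit Defensive.

(* Abelian group identities, which [ring] does not cover. *)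
Ltac zmod :=
  apply/eqP; rewrite -subr_eq0; apply/eqP;
  rewrite ?(opprD, opprB, opprK, oppr0, addr0, subr0) -[LHS]add0r;
  rewrite ?(addrA, opprD, opprK);
  repeat match goal with
  | |- context [- ?x] =>
    do 20? rewrite (addrAC _ (- x));
    apply/eqP; rewrite subr_eq0; apply/eqP;
    do 20? rewrite (addrAC _ x);
    rewrite -[RHS]add0r; congr (_ + x)
  end.

(** * Cohomologous cocycles on a fixed cover, and pullback along refinement maps *)

Section Cohomologous.
Variables (K : fieldType) (T : topologicalType) (O : algSheaf K T).
Variable F : modPresheaf O.
Implicit Types U V W : cover T.

Definition cohom1 W (a b : cech1 F W) := exists c : forall k, F (W k),
  forall k l, b k l - a k l = mres (@oIr T (W k) (W l)) (c l)
                              - mres (@oIl T (W k) (W l)) (c k).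

Definition cohom2 W (a b : cech2 F W) := exists c : forall k l, F (oI (W k) (W l)),
  forall k l m, b k l m - a k l m = mres (@f23 T (W k) (W l) (W m)) (c l m)
                                    - mres (@f13 T (W k) (W l) (W m)) (c k m)
                                    + mres (@f12 T (W k) (W l) (W m)) (c k l).

(** The four inclusions force [V] into the quadruple overlap, where the cocycle condition can be
    restricted. They are kept as arbitrary proofs so that the relation rewrites whatever composite
    restriction occurs. *)
Lemma cech2_rel U (a : cech2 F U) i j k l (V : opens T)
    (h123 : V `<=` oI3 (U i) (U j) (U k)) (h124 : V `<=` oI3 (U i) (U j) (U l))
    (h134 : V `<=` oI3 (U i) (U k) (U l)) (h234 : V `<=` oI3 (U j) (U k) (U l)) :
  mres h234 (a j k l) =
  mres h134 (a i k l) - mres h124 (a i j l) + mres h123 (a i j k).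
Proof.
have hV : V `<=` oI4 (U i) (U j) (U k) (U l).
  by move=> x Vx; split; [exact: h123 | have [] := h124 x Vx].
have := congr1 (mres hV) (c2P a i j k l); rewrite raddf0 raddfB raddfD raddfB /=.
rewrite !(mres_comp _ _ h123, mres_comp _ _ h124).
rewrite !(mres_comp _ _ h134, mres_comp _ _ h234).
by move/eqP; rewrite subr_eq0 => /eqP <-; zmod.
Qed.

Definition pull1 U W (r : cidx W -> cidx U) (hr : refines r) (a : cech1 F U) :
  cech1 F W.
Proof.
exists (fun k l => mres (oISS (hr k) (hr l)) (a (r k) (r l))) => k l m.
have h12 := subset_trans (@f12 T (W k) (W l) (W m)) (oISS (hr k) (hr l)).
have h23 := subset_trans (@f23 T (W k) (W l) (W m)) (oISS (hr l) (hr m)).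
have h13 := subset_trans (@f13 T (W k) (W l) (W m)) (oISS (hr k) (hr m)).
rewrite (mres_comp _ _ h12) (mres_comp _ _ h23) (mres_comp _ _ h13).
rewrite (cech1_rel a h12 h23 h13); zmod.
Defined.

Definition pull2 U W (r : cidx W -> cidx U) (hr : refines r) (a : cech2 F U) :
  cech2 F W.
Proof.
exists (fun k l m => mres (oI3SS (hr k) (hr l) (hr m)) (a (r k) (r l) (r m))) => k l m n.
have h123 := subset_trans (@f123 T (W k) (W l) (W m) (W n)) (oI3SS (hr k) (hr l) (hr m)).
have h124 := subset_trans (@f124 T (W k) (W l) (W m) (W n)) (oI3SS (hr k) (hr l) (hr n)).
have h134 := subset_trans (@f134 T (W k) (W l) (W m) (W n)) (oI3SS (hr k) (hr m) (hr n)).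
have h234 := subset_trans (@f234 T (W k) (W l) (W m) (W n)) (oI3SS (hr l) (hr m) (hr n)).
rewrite (mres_comp _ _ h123) (mres_comp _ _ h124) (mres_comp _ _ h134) (mres_comp _ _ h234).
rewrite (cech2_rel a h123 h124 h134 h234); zmod.
Defined.

Lemma cohom1_ext W (a b : cech1 F W) : (forall k l, a k l = b k l) -> cohom1 a b.
Proof. by move=> ab; exists (fun=> 0) => k l; rewrite ab /= !raddf0 subrr addr0. Qed.

Lemma cohom1_sym W (a b : cech1 F W) : cohom1 a b -> cohom1 b a.
Proof.
move=> [c ab]; exists (fun k => - c k) => k l.
by rewrite !raddfN /= -opprD -ab opprB.
Qed.

Lemma cohom1_trans W (a b e : cech1 F W) : cohom1 a b -> cohom1 b e -> cohom1 a e.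
Proof.
move=> [c ab] [d be]; exists (fun k => c k + d k) => k l.
rewrite -(subrKA (b k l)) ab be !raddfD /=; zmod.
Qed.

Lemma cohom1_pull U W (r : cidx W -> cidx U) (hr : refines r) (a b : cech1 F U) :
  cohom1 a b -> cohom1 (pull1 hr a) (pull1 hr b).
Proof.
move=> [c ab]; exists (fun k => mres (hr k) (c (r k))) => k l /=.
rewrite -raddfB ab raddfB /=.
have hl := subset_trans (@oIl T (W k) (W l)) (hr k).
have hr' := subset_trans (@oIr T (W k) (W l)) (hr l).
by rewrite !(mres_comp _ _ hl) !(mres_comp _ _ hr').
Qed.

(** The 0-cochain a_{r(k) s(k)} is the homotopy: the cocycle relation computes a_{r(k) s(l)} both
    through s(k) and through r(l), and the difference of the two expressions is the coboundary. *)
Lemma cohom1_homotopy U W (r s : cidx W -> cidx U) (hr : refines r) (hs : refines s)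
    (a : cech1 F U) : cohom1 (pull1 hr a) (pull1 hs a).
Proof.
have hrs k : W k `<=` oI (U (r k)) (U (s k)) by move=> x Wx; split; [exact: hr | exact: hs].
exists (fun k => mres (hrs k) (a (r k) (s k))) => k l /=.
have hk := subset_trans (@oIl T (W k) (W l)) (hrs k).
have hl := subset_trans (@oIr T (W k) (W l)) (hrs l).
rewrite (mres_comp _ _ hk) (mres_comp _ _ hl).
have hkl : oI (W k) (W l) `<=` oI (U (r k)) (U (s l)).
  by move=> x [Wk Wl]; split; [exact: hr | exact: hs].
have := cech1_rel a hk (oISS (hs k) (hs l)) hkl.
rewrite (cech1_rel a (oISS (hr k) (hr l)) hl hkl) => /eqP; rewrite addrC -subr_eq => /eqP <-.
zmod.
Qed.

Lemma cohom2_ext W (a b : cech2 F W) : (forall k l m, a k l m = b k l m) -> cohom2 a b.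
Proof.
by move=> ab; exists (fun _ _ => 0) => k l m; rewrite ab /= !raddf0 subrr !addr0.
Qed.

Lemma cohom2_sym W (a b : cech2 F W) : cohom2 a b -> cohom2 b a.
Proof.
move=> [c ab]; exists (fun k l => - c k l) => k l m.
by rewrite !raddfN /= -!opprD -ab opprB.
Qed.

Lemma cohom2_trans W (a b e : cech2 F W) : cohom2 a b -> cohom2 b e -> cohom2 a e.
Proof.
move=> [c ab] [d be]; exists (fun k l => c k l + d k l) => k l m.
rewrite -(subrKA (b k l m)) ab be !raddfD /=; zmod.
Qed.

Lemma cohom2_add W (a b a' b' : cech2 F W) :
  cohom2 a a' -> cohom2 b b' -> cohom2 (cech2_add a b) (cech2_add a' b').
Proof.
move=> [c aa'] [d bb']; exists (fun k l => c k l + d k l) => k l m /=.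
rewrite opprD addrACA aa' bb' !raddfD /=; zmod.
Qed.

Lemma cohom2_scale z W (a b : cech2 F W) :
  cohom2 a b -> cohom2 (cech2_scale z a) (cech2_scale z b).
Proof.
move=> [c ab]; exists (fun k l => Defs.cst O _ z *: c k l) => k l m /=.
by rewrite -scalerBr ab !mresZ !ares_cst -scalerBr -scalerDr.
Qed.

Lemma cohom2_pull U W (r : cidx W -> cidx U) (hr : refines r) (a b : cech2 F U) :
  cohom2 a b -> cohom2 (pull2 hr a) (pull2 hr b).
Proof.
move=> [c ab]; exists (fun k l => mres (oISS (hr k) (hr l)) (c (r k) (r l))) => k l m /=.
rewrite -raddfB ab raddfD raddfB /=.
have h12 := subset_trans (@f12 T (W k) (W l) (W m)) (oISS (hr k) (hr l)).
have h23 := subset_trans (@f23 T (W k) (W l) (W m)) (oISS (hr l) (hr m)).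
have h13 := subset_trans (@f13 T (W k) (W l) (W m)) (oISS (hr k) (hr m)).
by rewrite !(mres_comp _ _ h12) !(mres_comp _ _ h13) !(mres_comp _ _ h23).
Qed.

(** This is the prism operator in degree 2. Its coboundary is computed from the cocycle relation on
    the three tetrahedra of the prism: (rk, rl, rm, sm), (rk, rl, sl, sm) and (rk, sk, sl, sm). *)
Lemma cohom2_homotopy U W (r s : cidx W -> cidx U) (hr : refines r) (hs : refines s)
    (a : cech2 F U) : cohom2 (pull2 hr a) (pull2 hs a).
Proof.
have h k l : oI (W k) (W l) `<=` oI3 (U (r k)) (U (s k)) (U (s l)).
  by move=> x [Wk Wl]; split; [split; [exact: hr | exact: hs] | exact: hs].
have h' k l : oI (W k) (W l) `<=` oI3 (U (r k)) (U (r l)) (U (s l)).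
  by move=> x [Wk Wl]; split; [split; exact: hr | exact: hs].
exists (fun k l => mres (h k l) (a (r k) (s k) (s l)) - mres (h' k l) (a (r k) (r l) (s l)))
  => k l m /=.
rewrite !raddfB /=.
have k12 := subset_trans (@f12 T (W k) (W l) (W m)) (h k l).
have k23 := subset_trans (@f23 T (W k) (W l) (W m)) (h l m).
have k13 := subset_trans (@f13 T (W k) (W l) (W m)) (h k m).
have k12' := subset_trans (@f12 T (W k) (W l) (W m)) (h' k l).
have k23' := subset_trans (@f23 T (W k) (W l) (W m)) (h' l m).
have k13' := subset_trans (@f13 T (W k) (W l) (W m)) (h' k m).
rewrite (mres_comp _ _ k12) (mres_comp _ _ k13) (mres_comp _ _ k23).
rewrite (mres_comp _ _ k12') (mres_comp _ _ k13') (mres_comp _ _ k23').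
have rrs : oI3 (W k) (W l) (W m) `<=` oI3 (U (r k)) (U (r l)) (U (s m)).
  by move=> x [[Wk Wl] Wm]; split; [split; exact: hr | exact: hs].
have rss : oI3 (W k) (W l) (W m) `<=` oI3 (U (r k)) (U (s l)) (U (s m)).
  by move=> x [[Wk Wl] Wm]; split; [split; [exact: hr | exact: hs] | exact: hs].
rewrite (cech2_rel a (oI3SS (hr k) (hr l) (hr m)) rrs k13' k23').
rewrite (cech2_rel a k12' rrs rss k23) (cech2_rel a k12 k13 rss (oI3SS (hs k) (hs l) (hs m))).
zmod.
Qed.

End Cohomologous.

(** * Common refinements of covers *)

Section CommonRefinement.
Variable T : topologicalType.

Definition cover_meet (U V : cover T) : cover T.
Proof.
exists (cidx U * cidx V)%type (fun p => oI (U p.1) (V p.2)) => x.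
by have [[i Ui] [j Vj]] := (coverP U x, coverP V x); exists (i, j).
Defined.

Definition finer (W U : cover T) := exists r : cidx W -> cidx U, refines r.

Lemma finer_trans (V U W : cover T) : finer W V -> finer V U -> finer W U.
Proof.
by move=> [r hr] [s hs]; exists (s \o r) => k; exact: subset_trans (hr k) (hs _).
Qed.

Lemma finer_meetl (U V : cover T) : finer (cover_meet U V) U.
Proof. by exists fst => k; exact: oIl. Qed.

Lemma finer_meetr (U V : cover T) : finer (cover_meet U V) V.
Proof. by exists snd => k; exact: oIr. Qed.

End CommonRefinement.

(** * Cohomology classes across different covers, and the operations on H^2 *)

Section Classes.
Variables (K : fieldType) (T : topologicalType) (O : algSheaf K T).
Variable F : modPresheaf O.
Implicit Types U V W : cover T.

(** The refinement maps supplied by [cech1_eq] may be exchanged for any others, because two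
    pullbacks to the same cover are homotopic. This freedom allows several such relations to be
    combined on one common refinement. *)
Lemma cech1_eq_finer U V (a : cech1 F U) (b : cech1 F V) :
  cech1_eq (existT _ U a) (existT _ V b) ->
  exists W0, [/\ finer W0 U, finer W0 V & forall W, finer W W0 ->
    forall (r : cidx W -> cidx U) (s : cidx W -> cidx V) (hr : refines r) (hs : refines s),
    cohom1 (pull1 hr a) (pull1 hs b)].
Proof.
move=> [W0] /= [r0 [s0 [hr0 [hs0 ab]]]]; exists W0; split; [by exists r0 | by exists s0 |].
move=> W [t ht] r s hr hs.
(* Unfolded, [cech1_eq] is exactly [cohom1] of the two pullbacks to [W0]. *)
have {}ab : cohom1 (pull1 hr0 a) (pull1 hs0 b) by [].
(* Pulling back in two stages agrees with pulling back along the composite map. The [exists2] with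
   [True] only names the proof that the composite refines. *)
have compE (Z : cover T) (q : cidx W0 -> cidx Z) (hq : refines q) (e : cech1 F Z) :
    exists2 hqt : refines (q \o t), True & forall k l, pull1 ht (pull1 hq e) k l = pull1 hqt e k l.
  have hqt : refines (q \o t) by move=> k; exact: subset_trans (ht k) (hq _).
  by exists hqt => // k l /=; rewrite (mres_comp _ _ (oISS (hqt k) (hqt l))).
have [hu _ aE] := compE _ _ hr0 a; have [hv _ bE] := compE _ _ hs0 b.
apply: cohom1_trans (cohom1_homotopy hr hu a) _.
apply: cohom1_trans (cohom1_homotopy hv hs b).
apply: cohom1_trans (cohom1_sym (cohom1_ext aE)) _.
exact: cohom1_trans (cohom1_pull ht ab) (cohom1_ext bE).
Qed.

Lemma cech2_eq_finer U V (a : cech2 F U) (b : cech2 F V) :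
  cech2_eq (existT _ U a) (existT _ V b) ->
  exists W0, [/\ finer W0 U, finer W0 V & forall W, finer W W0 ->
    forall (r : cidx W -> cidx U) (s : cidx W -> cidx V) (hr : refines r) (hs : refines s),
    cohom2 (pull2 hr a) (pull2 hs b)].
Proof.
move=> [W0] /= [r0 [s0 [hr0 [hs0 ab]]]]; exists W0; split; [by exists r0 | by exists s0 |].
move=> W [t ht] r s hr hs.
have {}ab : cohom2 (pull2 hr0 a) (pull2 hs0 b) by [].
have compE (Z : cover T) (q : cidx W0 -> cidx Z) (hq : refines q) (e : cech2 F Z) :
    exists2 hqt : refines (q \o t), True &
      forall k l m, pull2 ht (pull2 hq e) k l m = pull2 hqt e k l m.
  have hqt : refines (q \o t) by move=> k; exact: subset_trans (ht k) (hq _).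
  by exists hqt => // k l m /=; rewrite (mres_comp _ _ (oI3SS (hqt k) (hqt l) (hqt m))).
have [hu _ aE] := compE _ _ hr0 a; have [hv _ bE] := compE _ _ hs0 b.
apply: cohom2_trans (cohom2_homotopy hr hu a) _.
apply: cohom2_trans (cohom2_homotopy hv hs b).
apply: cohom2_trans (cohom2_sym (cohom2_ext aE)) _.
exact: cohom2_trans (cohom2_pull ht ab) (cohom2_ext bE).
Qed.

Lemma cohom1_class U (a b : cech1 F U) :
  cohom1 a b -> cech1_eq (existT _ U a) (existT _ U b).
Proof.
move=> ab; have hid : refines (@id (cidx U)) by move=> k x.
by exists U, id, id, hid, hid; exact: (cohom1_pull hid ab).
Qed.

Lemma cohom2_class U (a b : cech2 F U) :
  cohom2 a b -> cech2_eq (existT _ U a) (existT _ U b).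
Proof.
move=> ab; have hid : refines (@id (cidx U)) by move=> k x.
by exists U, id, id, hid, hid; exact: (cohom2_pull hid ab).
Qed.

Lemma cech2_eq_refl U (a : cech2 F U) : cech2_eq (existT _ U a) (existT _ U a).
Proof. exact/cohom2_class/cohom2_ext. Qed.

Lemma cech1_eq_refl U (a : cech1 F U) : cech1_eq (existT _ U a) (existT _ U a).
Proof. exact/cohom1_class/cohom1_ext. Qed.

Lemma cech2_eq_sym (a b : {U : cover T & cech2 F U}) : cech2_eq a b -> cech2_eq b a.
Proof.
move=> [W [r [s [hr [hs ab]]]]]; exists W, s, r, hs, hr.
exact: (@cohom2_sym _ _ _ F W (pull2 hr (tagged a)) (pull2 hs (tagged b)) ab).
Qed.

(** Both relations are moved to the meet of their covers, with the same map [q] into the middle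
    cover, so that they share the pullback of [b]. *)
Lemma cech2_eq_trans (a b c : {U : cover T & cech2 F U}) :
  cech2_eq a b -> cech2_eq b c -> cech2_eq a c.
Proof.
case: a b c => [U a] [V b] [Z c] /cech2_eq_finer[W [WU WV ab]] /cech2_eq_finer[W' [_ WZ bc]].
have [WW WW'] := (finer_meetl W W', finer_meetr W W').
have [q hq] := finer_trans WW WV.
have [r hr] := finer_trans WW WU; have [s hs] := finer_trans WW' WZ.
exists (cover_meet W W'), r, s, hr, hs.
exact: cohom2_trans (ab _ WW _ _ hr hq) (bc _ WW' _ _ hq hs).
Qed.

Lemma class2_eq U V (a : cech2 F U) (b : cech2 F V) :
  cech2_eq (existT _ U a) (existT _ V b) -> class2 a = class2 b.
Proof.
move=> ab; apply/seteqP; split => w; rewrite /class2 /=; apply: cech2_eq_trans => //.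
exact: cech2_eq_sym.
Qed.

Lemma cech2_eq_add U V (a b : cech2 F U) (a' b' : cech2 F V) :
  cech2_eq (existT _ U a) (existT _ V a') -> cech2_eq (existT _ U b) (existT _ V b') ->
  cech2_eq (existT _ U (cech2_add a b)) (existT _ V (cech2_add a' b')).
Proof.
move=> /cech2_eq_finer[W [WU WV aa']] /cech2_eq_finer[W' [_ _ bb']].
have [WW WW'] := (finer_meetl W W', finer_meetr W W').
have [r hr] := finer_trans WW WU; have [s hs] := finer_trans WW WV.
exists (cover_meet W W'), r, s, hr, hs.
have [c cP] := cohom2_add (aa' _ WW _ _ hr hs) (bb' _ WW' _ _ hr hs).
by exists c => k l m; rewrite -cP /= !raddfD.
Qed.

Lemma cech2_eq_scale z U V (a : cech2 F U) (b : cech2 F V) :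
  cech2_eq (existT _ U a) (existT _ V b) ->
  cech2_eq (existT _ U (cech2_scale z a)) (existT _ V (cech2_scale z b)).
Proof.
move=> [W [r [s [hr [hs ab]]]]]; exists W, r, s, hr, hs.
have [c cP] := @cohom2_scale _ _ _ F z W (pull2 hr a) (pull2 hs b) ab.
by exists c => k l m; rewrite -cP /= !mresZ !ares_cst.
Qed.

(** [H2_add] ranges over all representatives on all covers. They yield a single class because the
    sum respects [cech2_eq]. *)
Lemma H2_add_class U (a b : cech2 F U) :
  H2_add (class2 a) (class2 b) = class2 (cech2_add a b).
Proof.
apply/seteqP; split => [w [V [a' [b' [aa' bb' w']]]] | w abw].
  exact: cech2_eq_trans (cech2_eq_add aa' bb') w'.
by exists U, a, b; split => //; exact: cech2_eq_refl.
Qed.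

Lemma H2_scale_class z U (a : cech2 F U) :
  H2_scale z (class2 a) = class2 (cech2_scale z a).
Proof.
apply/seteqP; split => [w [V [a' [aa' w']]] | w aw].
  exact: cech2_eq_trans (cech2_eq_scale z aa') w'.
by exists U, a; split => //; exact: cech2_eq_refl.
Qed.

End Classes.

(** * Products of 1-classes induced by a bilinear pairing of sheaves *)

Section Pairing.
Variables (K : fieldType) (T : topologicalType) (O : algSheaf K T).
Variables (F G H : modPresheaf O) (p : forall U : opens T, F U -> G U -> H U).
Hypothesis pDl : forall U x y z, @p U (x + y) z = p x z + p y z.
Hypothesis pDr : forall U x y z, @p U x (y + z) = p x y + p x z.
Hypothesis p_res : forall (U V : opens T) (h : V `<=` U) x y,
  mres h (p x y) = p (mres h x) (mres h y).
Variable prod : forall U : cover T, cech1 F U -> cech1 G U -> cech2 H U.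
Hypothesis prodE : forall (U : cover T) (a : cech1 F U) (b : cech1 G U) i j k,
  prod a b i j k = p (mres (@f12 T (U i) (U j) (U k)) (a i j))
                     (mres (@f23 T (U i) (U j) (U k)) (b j k)).

Lemma pairingBl U x y z : @p U (x - y) z = p x z - p y z.
Proof. by rewrite -[LHS](addrK (p y z)) -pDl subrK. Qed.

Lemma pairingBr U x y z : @p U x (y - z) = p x y - p x z.
Proof. by rewrite -[LHS](addrK (p x z)) -pDr subrK. Qed.

(** With a' - a = dc and b' - b = de, where e is the 0-cochain called [d] in the proof, passing
    through a b' gives a' b' - a b = (dc) b' + a (de). By the Leibniz rule for cochains this is the
    coboundary of c b' - a e. *)
Lemma cohom2_pairing (W : cover T) (a a' : cech1 F W) (b b' : cech1 G W) :
  cohom1 a a' -> cohom1 b b' -> cohom2 (prod a b) (prod a' b').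
Proof.
move=> [c aa'] [d bb'].
exists (fun k l => p (mres (@oIl T (W k) (W l)) (c k)) (b' k l)
                   - p (a k l) (mres (@oIr T (W k) (W l)) (d l))) => k l m.
rewrite !prodE -(subrKA (p (mres (@f12 T (W k) (W l) (W m)) (a k l))
                           (mres (@f23 T (W k) (W l) (W m)) (b' l m)))).
rewrite -pairingBl -pairingBr -!raddfB aa' bb' !raddfB /= !p_res.
have h1 := subset_trans (@f12 T (W k) (W l) (W m)) (@oIl T (W k) (W l)).
have h2 := subset_trans (@f12 T (W k) (W l) (W m)) (@oIr T (W k) (W l)).
have h3 := subset_trans (@f23 T (W k) (W l) (W m)) (@oIr T (W l) (W m)).
rewrite !(mres_comp _ _ h1) !(mres_comp _ _ h2) !(mres_comp _ _ h3).
rewrite (cech1_rel b' (@f12 T _ _ _) (@f23 T _ _ _) (@f13 T (W k) (W l) (W m))).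
rewrite (cech1_rel a (@f12 T _ _ _) (@f23 T _ _ _) (@f13 T (W k) (W l) (W m))).
rewrite pairingBl pairingBr pDl pDr; zmod.
Qed.

Lemma cech2_eq_pairing U V (a : cech1 F U) (b : cech1 G U) (a' : cech1 F V)
    (b' : cech1 G V) :
  cech1_eq (existT _ U a) (existT _ V a') -> cech1_eq (existT _ U b) (existT _ V b') ->
  cech2_eq (existT _ U (prod a b)) (existT _ V (prod a' b')).
Proof.
move=> /cech1_eq_finer[W [WU WV aa']] /cech1_eq_finer[W' [_ _ bb']].
have [WW WW'] := (finer_meetl W W', finer_meetr W W').
have [r hr] := finer_trans WW WU; have [s hs] := finer_trans WW WV.
exists (cover_meet W W'), r, s, hr, hs.
(* The product commutes with refinement, which reduces the claim to one cover. *)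
have prod_pull (U1 W1 : cover T) (q : cidx W1 -> cidx U1) (hq : refines q)
    (e : cech1 F U1) (f : cech1 G U1) k l m :
    mres (oI3SS (hq k) (hq l) (hq m)) (prod e f (q k) (q l) (q m)) =
    prod (pull1 hq e) (pull1 hq f) k l m.
  rewrite !prodE p_res /=.
  have h12 := subset_trans (oI3SS (hq k) (hq l) (hq m)) (@f12 T _ _ _).
  have h23 := subset_trans (oI3SS (hq k) (hq l) (hq m)) (@f23 T _ _ _).
  by rewrite !(mres_comp _ _ h12) !(mres_comp _ _ h23).
have [c cP] := cohom2_pairing (aa' _ WW _ _ hr hs) (bb' _ WW' _ _ hr hs).
by exists c => k l m; rewrite -cP /= -!prod_pull.
Qed.

End Pairing.

(** * The cup product and the bracket on classes *)

Section Products.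
Variables (K : fieldType) (T : topologicalType) (X : algSheaf K T).
Local Notation OX := (structure_module X).
Local Notation TX := (tangent X).

(** Products of any two representatives, on whatever cover, are equivalent by [cech2_eq_pairing],
    here for the action of functions on vector fields. *)
Lemma cup_class (U : cover T) (b : cech1 OX U) (D : cech1 TX U) :
  cup (class1 b) (class1 D) = class2 (cech_cup b D).
Proof.
apply/seteqP; split => [w [V [b' [D' [bb' DD' w']]]] | w bDw]; last first.
  by exists U, b, D; split => //; exact: cech1_eq_refl.
apply: cech2_eq_trans w'; pose p (V : opens T) (x : OX V) (y : TX V) : TX V := (x : X V) *: y.
apply: (@cech2_eq_pairing _ _ _ OX TX TX p _ _ _ (@cech_cup _ _ _)) => //.
- by move=> *; exact: scalerDl.
- by move=> *; exact: scalerDr.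
- by move=> *; exact: mresZ.
Qed.

Lemma bracket_class (U : cover T) (D E : cech1 TX U) :
  bracket (class1 D) (class1 E) = class2 (cech_bracket D E).
Proof.
apply/seteqP; split => [w [V [D' [E' [DD' EE' w']]]] | w DEw]; last first.
  by exists U, D, E; split => //; exact: cech1_eq_refl.
apply: cech2_eq_trans w'.
apply: (@cech2_eq_pairing _ _ _ TX TX TX (@der_bracket _ _ _) _ _ _ (@cech_bracket _ _ _)) => //.
- by move=> V0 x y z; apply: der_ext => W h f /=; rewrite der_add; ring.
- by move=> V0 x y z; apply: der_ext => W h f /=; rewrite der_add; ring.
- by move=> V0 W h x y; apply: der_ext.
Qed.

End Products.

(** * Automorphisms of A[t]/(t^3) and their second-order terms *)

Section SecondOrder.

Section Tri.
Variable A : comPzRingType.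

Definition tri (a b c : A) : tpoly 3 A := [ffun k : 'I_3 => [:: a; b; c]`_k].

Lemma tcoef_tri a b c k : (k < 3)%N -> tcoef (tri a b c) k = [:: a; b; c]`_k.
Proof. by move=> k3; rewrite -[k in LHS]/(nat_of_ord (Ordinal k3)) tcoefE ffunE. Qed.

Lemma tpoly_eq n (x y : tpoly n A) :
  (forall k, (k < n)%N -> tcoef x k = tcoef y k) -> x = y.
Proof. by move=> xy; apply/ffunP => k; rewrite -!tcoefE xy. Qed.

Lemma triE (x : tpoly 3 A) : x = tri (tcoef x 0) (tcoef x 1) (tcoef x 2).
Proof.
apply: tpoly_eq => k k3; rewrite tcoef_tri //.
by case: k k3 => [|[|[|]]].
Qed.

Lemma triD a b c a' b' c' :
  tri a b c + tri a' b' c' = tri (a + a') (b + b') (c + c').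
Proof.
apply: tpoly_eq => k k3; rewrite tcoefD !tcoef_tri //.
by case: k k3 => [|[|[|]]].
Qed.

Lemma triM a b c a' b' c' : tri a b c * tri a' b' c' =
  tri (a * a') (a * b' + b * a') (a * c' + b * b' + c * a').
Proof.
apply: tpoly_eq => k k3; rewrite tcoef_mul // tcoef_tri //.
case: k k3 => [|[|[|]]] // _; rewrite !big_ord_recr big_ord0 /= !tcoef_tri //=;
  by rewrite ?add0r.
Qed.

Lemma tri_mon0 a : tmon a 0 = tri a 0 0.
Proof.
apply: tpoly_eq => k k3; rewrite tcoef_mon // tcoef_tri //.
by case: k k3 => [|[|[|]]].
Qed.

Lemma tri_mon1 b : tmon b 1 = tri 0 b 0.
Proof.
apply: tpoly_eq => k k3; rewrite tcoef_mon // tcoef_tri //.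
by case: k k3 => [|[|[|]]].
Qed.

Lemma tri_mon2 c : tmon c 2 = tri 0 0 c.
Proof.
apply: tpoly_eq => k k3; rewrite tcoef_mon // tcoef_tri //.
by case: k k3 => [|[|[|]]].
Qed.

Lemma tri_decomp a b c : tri a b c =
  tri a 0 0 + tri b 0 0 * tri 0 1 0 + tri c 0 0 * (tri 0 1 0 * tri 0 1 0).
Proof. by rewrite !triM !triD; congr tri; ring. Qed.

End Tri.

Lemma tri_map (A B : comPzRingType) (f : {rmorphism A -> B}) a b c :
  tmap f (tri a b c) = tri (f a) (f b) (f c).
Proof.
apply: tpoly_eq => k k3; rewrite tcoef_map !tcoef_tri //.
by case: k k3 => [|[|[|]]].
Qed.

(** The ring is generated by the constants and t, so [g] is determined by its values there. Since
    t^3 = 0, the image t + u t^2 of t has square t^2. *)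
Lemma tri_rmorph (A : comPzRingType) (g : {rmorphism tpoly 3 A -> tpoly 3 A})
    (d e : A -> A) (u : A) :
  (forall f, g (tri f 0 0) = tri f (d f) (e f)) -> g (tri 0 1 0) = tri 0 1 u ->
  forall a b c, g (tri a b c) = tri a (d a + b) (e a + d b + u * b + c).
Proof.
move=> gf gt a b c; rewrite tri_decomp !(rmorphD, rmorphM) !gf gt !triM !triD.
by congr tri; ring.
Qed.

Variables (K : fieldType) (T : topologicalType) (X : algSheaf K T).
Implicit Types U V W : opens T.

Lemma der0 U (D : der X U) V (k : V `<=` U) : dfun D k 0 = 0.
Proof. by rewrite -[X in dfun D k X](rmorph0 (Defs.cst X V)) der_cst. Qed.

(** This is the operator E in f |-> f + D(f) t + E(f) t^2. *)
Definition gcoef2 U (g : gaut X 3 U) V (k : V `<=` U) (f : X V) : X V :=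
  tcoef (gfun g k (tri f 0 0)) 2.

(** Reduction modulo t^2 fixes the term D, and g(t) = u t depends only on u modulo t^2. The only
    freedom left in a lift is E, that is [gcoef2]. *)
Lemma lift_expansion U (g : gaut X 3 U) (h : h2grp X U) (D : der X U) (b : X U) :
  tau2_lift g h -> h2u h = tmon 1 0 + tmon b 1 ->
  (forall V (k : V `<=` U) f,
     gfun (h2phi h) k (tmon f 0) = tmon f 0 + tmon (dfun D k f) 1) ->
  forall V (k : V `<=` U) x y z, gfun g k (tri x y z) =
    tri x (dfun D k x + y) (gcoef2 g k x + dfun D k y + ares k b * y + z).
Proof.
move=> [gh [u [gt uh]]] hu hphi V k; apply: tri_rmorph => [f|].
  rewrite [LHS]triE gfun_mod tcoef_tri //=; congr tri.
  have := congr1 (fun x => tcoef x 1) (gh V k (tri f 0 0)).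
  have -> : ttrunc 2 (tri f 0 0) = tmon f 0.
    by apply/ffunP => i; rewrite !ffunE tcoef_tri ?ltnS ?(ltnW (ltn_ord i)) //;
       case: i => [[|[|]]].
  rewrite hphi tcoefD !tcoef_mon //= add0r => <-.
  by rewrite -[1%N in RHS]/(nat_of_ord (Ordinal (isT : 1 < 2)%N)) tcoefE ffunE.
have gt' : gfun g (@orefl T U) (tmon 1 1) = tri 0 1 b.
  rewrite gt tri_mon1 [u in LHS]triE triM.
  have uE (i : 'I_2) : tcoef u i = [:: 1; b]`_i.
    have := congr1 (fun x : tpoly 2 (X U) => x i) uh; rewrite ffunE => ->.
    by rewrite hu !ffunE; case: i => [[|[|]]] //= _; rewrite ?addr0 ?add0r.
  have [u0 u1] := (uE (Ordinal (isT : 0 < 2)%N), uE (Ordinal (isT : 1 < 2)%N)).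
  by rewrite /= in u0 u1; rewrite u0 u1; congr tri; ring.
(* The value on t is known over [U] only. As t is the restriction of t, compatibility of [g] with
   restriction carries it to [V]. *)
have -> : tri 0 1 0 = tmap (ares k) (tmon 1 1 : tpoly 3 (X U)).
  by rewrite tri_mon1 tri_map !rmorph0 rmorph1.
by rewrite (gfun_res g (@orefl T U) k k) gt' tri_map rmorph0 rmorph1.
Qed.

Section HalfSquare.
Variables (U : opens T) (g : gaut X 3 U) (D : der X U) (b : X U).
Hypothesis gE : forall V (k : V `<=` U) x y z, gfun g k (tri x y z) =
  tri x (dfun D k x + y) (gcoef2 g k x + dfun D k y + ares k b * y + z).
Variable q : K.
Hypothesis q2 : q + q = 1.

Lemma gcoef2E V (k : V `<=` U) f : gfun g k (tri f 0 0) = tri f (dfun D k f) (gcoef2 g k f).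
Proof. by rewrite gE der0 mulr0 !addr0. Qed.

(* D^2/2 is a second-order term with the same defect as [gcoef2 g] in the
   Leibniz rule, so that the difference is a derivation. *)
Definition second_der : der X U.
Proof.
exists (fun V k f => gcoef2 g k f - Defs.cst X V q * dfun D k (dfun D k f)).
- move=> V k x y; rewrite !der_add.
  have -> : gcoef2 g k (x + y) = gcoef2 g k x + gcoef2 g k y.
    have -> : gcoef2 g k (x + y) = tcoef (gfun g k (tri x 0 0 + tri y 0 0)) 2.
      by rewrite triD !addr0.
    by rewrite rmorphD tcoefD.
  ring.
- move=> V k x y.
  (* The cross term D(x) D(y) comes from the t^2 coefficient of g(x) g(y). Its coefficient 1 is
     written as q + q so that [ring] cancels it against the two cross terms of q D^2(xy). *)
  have -> : gcoef2 g k (x * y) =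
    x * gcoef2 g k y + (Defs.cst X V q + Defs.cst X V q) * (dfun D k x * dfun D k y)
    + gcoef2 g k x * y.
    have -> : gcoef2 g k (x * y) = tcoef (gfun g k (tri x 0 0 * tri y 0 0)) 2.
      by rewrite triM !mulr0 !mul0r !addr0.
    by rewrite -rmorphD q2 rmorph1 mul1r rmorphM !gcoef2E triM tcoef_tri.
  rewrite !der_mul !der_add !der_mul; ring.
- move=> V k c; rewrite /gcoef2 -tri_mon0 gfun_cst tri_mon0 tcoef_tri //= der_cst.
  by rewrite der0 mulr0 subr0.
- move=> V W k l m f; rewrite !(der_res D k l m) rmorphB rmorphM ares_cst; congr (_ - _).
  rewrite /gcoef2; have -> : tri (ares l f) 0 0 = tmap (ares l) (tri f 0 0).
    by rewrite tri_map !rmorph0.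
  by rewrite (gfun_res g k l m) tcoef_map.
Defined.

End HalfSquare.

Lemma ker_tau2_expansion U (g : gaut X 3 U) (D : der X U) : is_ker_tau2 g D ->
  forall V (k : V `<=` U) x y z, gfun g k (tri x y z) = tri x y (dfun D k x + z).
Proof.
move=> gD V k x y z; have [gt gf] := gD V k.
rewrite (@tri_rmorph _ _ (fun=> 0) (dfun D k) 0) ?add0r ?mul0r ?addr0 //.
  by move=> f; rewrite -tri_mon0 gf tri_mon0 tri_mon2 triD !add0r !addr0.
by rewrite -tri_mon1 gt.
Qed.

End SecondOrder.

(** * The obstruction cocycle compared with the explicit one *)

Section Obstruction.
Variables (K : fieldType) (T : topologicalType) (X : algSheaf K T).
Variables (h : h2cocycle X) (D : cech1 (tangent X) (hcov h)).
Variable b : cech1 (structure_module X) (hcov h).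
Hypothesis hnf : normal_form D b.
Variable q : K.
Hypothesis q2 : q + q = 1.

(** The lifts are arbitrary, so their cocycle is only cohomologous to the explicit one. The
    derivations F_ij, given by [second_der], form the cochain whose coboundary is the difference. *)
Lemma Delta2_representative (w : H2 (tangent X)) : is_Delta2 h w ->
  w = class2 (cech2_add (cech_cup b D) (cech2_scale q (cech_bracket D D))).
Proof.
move=> [g [c [lift inv ker ->]]]; apply/class2_eq/cech2_eq_sym/cohom2_class.
have gE i j := lift_expansion (lift i j) (hnf i j).1 (fun V k => ((hnf i j).2 V k).2).
exists (fun i j => second_der (gE i j) q2) => i j k.
apply: der_ext => V hV f /=.
pose hij := subset_trans hV (@f12 T (hcov h i) (hcov h j) (hcov h k)).
pose hjk := subset_trans hV (@f23 T (hcov h i) (hcov h j) (hcov h k)).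
pose hik := subset_trans hV (@f13 T (hcov h i) (hcov h j) (hcov h k)).
pose hki := subset_trans hV (@f31 T (hcov h i) (hcov h j) (hcov h k)).
have D_add x : dfun (D i k) hik x = dfun (D i j) hij x + dfun (D j k) hjk x.
  have := congr1 (fun e => dfun e (@orefl T V) x) (cech1_rel D hij hjk hik).
  rewrite /= (Prop_irrelevance (subset_trans _ hik) hik).
  by rewrite (Prop_irrelevance (subset_trans _ hij) hij) (Prop_irrelevance (subset_trans _ hjk) hjk).
have inv_ki x : gfun (g k i) hki (gfun (g i k) hik x) = x.
  have := congr1 (fun e => gfun e hki x) (inv k i).
  by rewrite /= (Prop_irrelevance (subset_trans hki _) hik).
(* The triple product is evaluated at g_ik(f), on which g_ki gives back f. This yields g_ij g_jk(f)
   = g_ik(f) + c_ijk(f) t^2 without expanding the inverse. *)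
have := ker_tau2_expansion (ker i j k) hV f (dfun (D i k) hik f) (gcoef2 (g i k) hik f).
rewrite -(gcoef2E (gE i k)) /= -/hij -/hjk -/hki inv_ki (gcoef2E (gE j k)) gE.
move=> /(congr1 (fun x => tcoef x 2)); rewrite !tcoef_tri //=.
rewrite (ares_comp _ _ hij) ares_cst -/hik => /eqP; rewrite -subr_eq => /eqP <-.
rewrite !D_add !der_add; set P := dfun _ hij (dfun _ hjk f); set Q := dfun _ hjk (dfun _ hij f).
(* The term D_ij D_jk(f) is split into two halves, since [ring] does not know that q + q = 1. One
   half goes into the bracket, the other into the square of D_ik = D_ij + D_jk. *)
have e : P = (Defs.cst X V q + Defs.cst X V q) * P by rewrite -rmorphD q2 rmorph1 mul1r.
rewrite [X in _ + X + _ + _]e; ring.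
Qed.

End Obstruction.

End CechObstruction.

Theorem mainTheorem7 (R : realType) (T : topologicalType) (X : algSheaf R[i] T)
    (d : nat) (hX : smooth_projective_variety X d)
    (X2 : algSheaf R[i] T) (rho : algSheafMor X2 X)
    (hX2 : primitive_multiple_scheme rho d 2)
    (hL : associated_bundle_trivial rho)
    (LL : modPresheaf X2) (hLL : line_bundle LL) (hext : extends_ideal rho LL)
    (eta : set (h2cocycle X)) (heta : eta = pair_class rho LL)
    (h : h2cocycle X) (hh : eta h)
    (D : cech1 (tangent X) (hcov h)) (b : cech1 (structure_module X) (hcov h))
    (hnf : normal_form D b)
    (sigma : H1 (tangent X)) (hsigma : sigma = class1 D)
    (theta : H1 (structure_module X)) (htheta : theta = class1 b)
    (Delta2 : H2 (tangent X)) (hDelta2 : is_Delta2 h Delta2) :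
  Delta2 = H2_add (cup theta sigma) (H2_scale 2^-1 (bracket sigma sigma)).
Proof.
have q2 : 2^-1 + 2^-1 = 1 :> R[i].
  by rewrite -mulr2n -[LHS]mulr_natr mulVf // Num.Theory.pnatr_eq0.
(* All classes on the right have representatives on the cover of [h], so that side becomes the class
   of a single explicit cocycle. *)
rewrite hsigma htheta cup_class bracket_class H2_scale_class H2_add_class.
by rewrite (Delta2_representative hnf q2 hDelta2).
Qed.
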